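(* For every integer $d\ge 1$ there exists an integer $N=N(d)\ge 1$ such that, for every field $k$, if $(A_1,\dots,A_N)\in\mathcal{N}_d^N(k)$, then $A_N\cdots A_1=0$.
   Context: $M_d(k)$ is the algebra of $d\times d$ matrices over the field $k$. For $n\ge 1$, $\mathcal{N}_d^n(k)$ denotes the set of $n$-tuples $(A_1,\dots,A_n)\in M_d(k)^n$ such that the product $A_jA_{j-1}\cdots A_i$ is nilpotent for all $1\le i\le j\le n$. *)

(* Defs.v *)
From mathcomp Require Import all_boot all_order all_algebra.
Set Implicit Arguments.
Unset Strict Implicit.
Unset Printing Implicit Defensive.
Import GRing.Theory.
Local Open Scope ring_scope.

Definition nilpotent_mx (k : fieldType) (d : nat) (M : 'M[k]_d) : Prop :=
  exists m : nat, M ^+ m = 0.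

(* A_j A_(j-1) ... A_i, with tuple positions counted from 0; the reversed
   enumeration puts the factor of largest index leftmost. *)
Definition seg_prod (k : fieldType) (d n : nat) (A : n.-tuple 'M[k]_d)
    (i j : 'I_n) : 'M[k]_d :=
  \prod_(l <- rev (enum 'I_n) | (i <= l <= j)%N) tnth A l.

Definition nilpotent_chain (k : fieldType) (d n : nat) (A : n.-tuple 'M[k]_d) : Prop :=
  forall i j : 'I_n, (i <= j)%N -> nilpotent_mx (seg_prod A i j).

(* Main.v *)
Require Import Defs.
From mathcomp Require Import all_boot all_order all_algebra.
Set Implicit Arguments.
Unset Strict Implicit.
Unset Printing Implicit Defensive.
Import GRing.Theory.
Local Open Scope ring_scope.

(** The rank of a long product is forced down one unit at a time.  Suppose
    that every product of [N] consecutive matrices has rank at most [s > 0], and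
    cut a longer product into blocks [B_0, ..., B_(m-1)] of [N] matrices.  Write
    [B_i = C_i R_i], where [C_i] has [s] columns and [R_i] has [s] rows.

    If [R_(i+1) C_i] is singular for some [i], then [B_(i+1) B_i], hence the
    whole product, has rank less than [s].  Otherwise
    [B_j ... B_i = C_j G R_i] with an invertible [G], and the nilpotency of this
    product forces [det (R_i C_j) = 0] for all [i <= j]
    ([nilpotent_det_factor]).  So the table with entries [det (R_(i+1) C_j)],
    for [i, j < m-1], is triangular with a nonzero diagonal: in geometric terms,
    the image of [B_j] meets the kernel of [B_i] nontrivially for [i <= j], but
    meets that of [B_(j+1)] trivially.  This is the situation of the skew form
    of Bollobas's theorem on set pairs, for subspaces, and the exterior algebra
    argument of Lovasz bounds the length of such a system ([skew_bollobas]):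
    by multilinearity, the table factors through a space whose dimension
    depends on [d] and [s] only, and over any field its rank is [m-1].

    Hence [m = d ^ s + 2] blocks always suffice to lose one unit of rank, and
    starting from the trivial bound [d] for a single matrix, [d] rounds reach
    rank [0]. *)

(** * Rank factorizations *)

(** Padding by partial identities gives an inner dimension [s] that is the same
    for all matrices of rank at most [s]. *)
Definition lfactor (k : fieldType) (d s : nat) (M : 'M[k]_d) : 'M[k]_(d, s) :=
  col_base M *m pid_mx (\rank M).

Definition rfactor (k : fieldType) (d s : nat) (M : 'M[k]_d) : 'M[k]_(s, d) :=
  pid_mx (\rank M) *m row_base M.

Lemma mul_lfactor_rfactor (k : fieldType) (d s : nat) (M : 'M[k]_d) :
  (\rank M <= s)%N -> lfactor s M *m rfactor s M = M.
Proof.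
move=> rM; rewrite /lfactor /rfactor mulmxA -(mulmxA (col_base M)).
by rewrite pid_mx_id // pid_mx_1 mulmx1 mulmx_base.
Qed.

Lemma det0_rank_lt (k : fieldType) (s : nat) (M : 'M[k]_s.+1) :
  \det M = 0 -> (\rank M <= s)%N.
Proof.
move=> M0; rewrite -ltnS ltn_neqAle rank_leq_row andbT.
by rewrite -[_ == _]/(row_free M) row_free_unit unitmxE M0 unitr0.
Qed.

(** * Determinantal form of the skew set-pair inequality *)

Lemma det_mulmx_sum (k : fieldType) (s d : nat)
    (R : 'M[k]_(s, d)) (C : 'M[k]_(d, s)) :
  \det (R *m C) =
    \sum_(f : {ffun 'I_s -> 'I_d})
      (\prod_x R x (f x)) * \det (\matrix_(x, y) C (f x) y).
Proof.
rewrite /determinant.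
under [RHS]eq_bigr do rewrite mulr_sumr.
rewrite exchange_big /=; apply: eq_bigr => p _.
under eq_bigr do rewrite mxE.
rewrite bigA_distr_bigA mulr_sumr /=; apply: eq_bigr => f _.
rewrite big_split /= mulrCA; congr (_ * (_ * _)).
by apply: eq_bigr => x _; rewrite mxE.
Qed.

(** The expansion of [det (R_i C_j)] writes the table of these determinants as a
    product of two matrices with inner dimension [d ^ s], the number of maps
    from ['I_s] to ['I_d]; the table is invertible, being triangular. *)
Lemma skew_bollobas (k : fieldType) (s d m : nat)
    (R : 'I_m -> 'M[k]_(s, d)) (C : 'I_m -> 'M[k]_(d, s)) :
    (forall i, \det (R i *m C i) != 0) ->
    (forall i j : 'I_m, (i < j)%N -> \det (R i *m C j) = 0) ->
  (m <= d ^ s)%N.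
Proof.
move=> diag skew.
pose F := {ffun 'I_s -> 'I_d}.
pose U : 'M[k]_(m, #|F|) :=
  \matrix_(i, f) \prod_x R i x ((enum_val f : F) x).
pose V : 'M[k]_(#|F|, m) :=
  \matrix_(f, j) \det (\matrix_(x, y) C j ((enum_val f : F) x) y).
have UV i j : (U *m V) i j = \det (R i *m C j).
  rewrite mxE det_mulmx_sum (reindex (@enum_val F predT)) /=; last first.
    by apply/onW_bij/enum_val_bij.
  by apply: eq_bigr => f _; rewrite !mxE.
have UVunit : U *m V \in unitmx.
  rewrite unitmxE det_trig; last first.
    by apply/is_trig_mxP => i j ij; rewrite UV skew.
  by rewrite unitfE; apply/prodf_neq0 => i _; rewrite UV.
rewrite -(mxrank_unit UVunit).
by apply: leq_trans (mulmx_max_rank _ _) _; rewrite card_ffun !card_ord.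
Qed.

(** * Nilpotency and determinants *)

Lemma det_expr (k : fieldType) (s n : nat) (X : 'M[k]_s) :
  \det (X ^+ n) = \det X ^+ n.
Proof.
by elim: n => [|n IHn]; rewrite ?det1 // !exprS det_mulmx IHn.
Qed.

(** [C G R] and [R C G] have the same nonzero spectrum, so the second one is
    nilpotent as soon as the first one is. *)
Lemma nilpotent_det_factor (k : fieldType) (d s : nat)
    (C : 'M[k]_(d, s.+1)) (G : 'M[k]_s.+1) (R : 'M[k]_(s.+1, d)) :
  nilpotent_mx (C *m G *m R) -> \det G != 0 -> \det (R *m C) = 0.
Proof.
move=> [n Mn0] G0.
have swap l : R *m (C *m G *m R) ^+ l = (R *m C *m G) ^+ l *m R.
  elim: l => [|l IHl]; first by rewrite !expr0 mulmx1 mul1mx.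
  by rewrite !exprSr -!mulmxE mulmxA IHl !mulmxA.
have Xn0 : (R *m C *m G) ^+ n.+1 = 0.
  by rewrite exprSr -mulmxE !mulmxA -swap Mn0 mulmx0 !mul0mx.
have := det_expr n.+1 (R *m C *m G).
rewrite Xn0 det0 det_mulmx => /esym/eqP.
by rewrite expf_eq0 mulf_eq0 (negPf G0) orbF => /andP[_ /eqP].
Qed.

(** * Products along infinite sequences *)

Definition iprod (k : fieldType) (d : nat) (A : nat -> 'M[k]_d) (a b : nat) :
    'M[k]_d :=
  \prod_(l <- rev (index_iota a b)) A l.

Definition nilpotent_seq (k : fieldType) (d : nat) (A : nat -> 'M[k]_d) :=
  forall a b, (a < b)%N -> nilpotent_mx (iprod A a b).

Section Products.

Variables (k : fieldType) (d : nat).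
Implicit Types A B : nat -> 'M[k]_d.

Lemma iprod_nil A a : iprod A a a = 1.
Proof. by rewrite /iprod /index_iota subnn big_nil. Qed.

Lemma iprod1 A a : iprod A a a.+1 = A a.
Proof. by rewrite /iprod /index_iota subSnn big_seq1. Qed.

Lemma iprod_cat A a b c : (a <= b <= c)%N ->
  iprod A a c = iprod A b c *m iprod A a b.
Proof.
case/andP=> ab bc; rewrite /iprod mulmxE -big_cat -rev_cat /index_iota.
by rewrite -{2}(subnKC ab) -iotaD addnC addnBA // subnK.
Qed.

Lemma iprod_recr A a b : (a <= b)%N ->
  iprod A a b.+1 = A b *m iprod A a b.
Proof. by move=> ab; rewrite (@iprod_cat _ _ b) ?ab ?leqnSn // iprod1. Qed.

Lemma iprod_block A N i j : (i <= j)%N ->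
  iprod (fun l => iprod A (l * N) (l.+1 * N)) i j =
    iprod A (i * N) (j * N).
Proof.
elim: j => [|j IHj]; first by rewrite leqn0 => /eqP ->; rewrite !iprod_nil.
rewrite leq_eqVlt => /predU1P[-> | ij]; first by rewrite !iprod_nil.
rewrite iprod_recr // IHj // -iprod_cat //.
by rewrite !leq_mul2r leqnSn (ltnSE ij) !orbT.
Qed.

Lemma iprod_shift A c a b :
  iprod (fun l => A (c + l)%N) a b = iprod A (c + a) (c + b).
Proof. by rewrite /iprod /index_iota subnDl iotaDl -map_rev big_map. Qed.

Lemma nilpotent_seq_shift A c :
  nilpotent_seq A -> nilpotent_seq (fun l => A (c + l)%N).
Proof.
by move=> nA a b ab; rewrite iprod_shift; apply: nA; rewrite ltn_add2l.
Qed.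

Lemma nilpotent_seq_block A N : (0 < N)%N -> nilpotent_seq A ->
  nilpotent_seq (fun l => iprod A (l * N) (l.+1 * N)).
Proof.
move=> N0 nA i j ij; rewrite iprod_block ?(ltnW ij) //.
by apply: nA; rewrite ltn_mul2r N0.
Qed.

(** * Losing one unit of rank *)

Lemma rank_iprod_adjacent A i m : (i.+1 < m)%N ->
  (\rank (iprod A 0 m) <= \rank (A i.+1 *m A i))%N.
Proof.
move=> im; rewrite (@iprod_cat _ 0 i.+2) //.
apply: leq_trans (mxrankM_maxr _ _) _.
rewrite !iprod_recr // mulmxA; exact: mxrankM_maxl.
Qed.

(** In a product of factored blocks, the inner pairs [R_(l+1) C_l] are square
    and make up [G]; only the outer factors [C_j] and [R_i] stay rectangular. *)
Lemma iprod_factor s A (C : nat -> 'M[k]_(d, s)) (R : nat -> 'M[k]_(s, d)) i j :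
    (forall l, A l = C l *m R l) ->
    (i <= j)%N -> (forall l, (i <= l < j)%N -> \det (R l.+1 *m C l) != 0) ->
  exists2 G : 'M[k]_s, \det G != 0 & iprod A i j.+1 = C j *m G *m R i.
Proof.
move=> ACR; elim: j => [|j IHj].
  rewrite leqn0 => /eqP -> _; exists 1%:M; first by rewrite det1 oner_eq0.
  by rewrite iprod1 ACR mulmx1.
rewrite leq_eqVlt => /predU1P[-> _ | ij nz].
  by exists 1%:M; rewrite ?det1 ?oner_eq0 // iprod1 ACR mulmx1.
have [|l /andP[il lj]|G G0 EG] := IHj.
- exact: ltnSE.
- by apply: nz; rewrite il ltnW.
exists (R j.+1 *m C j *m G).
  by rewrite det_mulmx mulf_neq0 // nz // (ltnSE ij) leqnn.
by rewrite iprod_recr ?(ltnW ij) // EG ACR !mulmxA.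
Qed.

(** The table [det (R_(i+1) C_j)] is too large for [skew_bollobas] once it has
    [d ^ s.+1 + 1] rows; the shift of index in [R_(i+1)] costs one more factor. *)
Lemma rank_drop s A :
    (forall l, (\rank (A l) <= s.+1)%N) -> nilpotent_seq A ->
  (\rank (iprod A 0 (d ^ s.+1).+2) <= s)%N.
Proof.
move=> rA nA; set m := (d ^ s.+1).+1.
pose C l := lfactor s.+1 (A l); pose R l := rfactor s.+1 (A l).
have ACR l : A l = C l *m R l by rewrite mul_lfactor_rfactor.
have [/existsP[i /eqP det0i] | /existsPn nz] :=
  boolP [exists i : 'I_m, \det (R i.+1 *m C i) == 0].
  apply: leq_trans (@rank_iprod_adjacent _ i _ _) _; first by rewrite ltnS.
  rewrite (ACR i.+1) (ACR i) mulmxA -(mulmxA (C _)).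
  apply: leq_trans (mxrankM_maxl _ _) _.
  by apply: leq_trans (mxrankM_maxr _ _) _; apply: det0_rank_lt.
suff: (m <= d ^ s.+1)%N by rewrite ltnn.
apply: (@skew_bollobas k s.+1 d m (fun i => R i.+1) (fun i => C i))
  => [i | i j ij]; first exact: nz.
have [l /andP[_ lj]|G G0 EG] := iprod_factor ACR ij.
  exact: (nz (Ordinal (ltn_trans lj (ltn_ord j)))).
apply: (nilpotent_det_factor _ G0); rewrite -EG; exact: nA.
Qed.

End Products.

(** The quantification over all infinite sequences is what makes the induction
    go through: any block of consecutive terms is an initial segment of a
    shifted sequence, so the bound for [r] applies to all blocks at once. *)
Lemma uniform_rank_bound (d r : nat) :
  exists2 N : nat, (0 < N)%N &
    forall (k : fieldType) (A : nat -> 'M[k]_d),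
      nilpotent_seq A -> (\rank (iprod A 0 N) <= d - r)%N.
Proof.
elim: r => [|r [N N0 IHr]].
  by exists 1%N => // k A _; rewrite subn0 rank_leq_row.
have [dr | rd] := leqP d r.
  exists N => // k A nA; apply: leq_trans (IHr k A nA) _.
  by move: dr; rewrite -subn_eq0 => /eqP ->.
exists ((d ^ (d - r.+1).+1).+2 * N)%N; first by rewrite muln_gt0 N0.
move=> k A nA.
rewrite -(mul0n N) -iprod_block //; apply: rank_drop; last first.
  exact: nilpotent_seq_block.
move=> l; rewrite subnSK // mulSnr -{1}(addn0 (l * N)%N) -iprod_shift.
exact/IHr/nilpotent_seq_shift.
Qed.

(** * From infinite sequences to tuples *)

(** Extending a tuple by zero creates only products that vanish, so nilpotency
    of the consecutive products survives the passage to infinite sequences. *)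
Lemma nilpotent_seq_tuple (k : fieldType) (d n : nat) (A : n.-tuple 'M[k]_d) :
  nilpotent_chain A -> nilpotent_seq (fun l => nth 0 A l).
Proof.
move=> nA a [//|b] ab; have [bn | nb] := ltnP b n; last first.
  exists 1%N; rewrite expr1 iprod_recr // nth_default ?mul0mx //.
  by rewrite size_tuple.
pose i := Ordinal (leq_trans ab bn); pose j := Ordinal bn.
suff -> : iprod (fun l => nth 0 A l) a b.+1 = seg_prod A i j by apply: nA.
rewrite /seg_prod /iprod.
under [RHS]eq_bigr => l _ do rewrite (tnth_nth 0).
have -> : rev (index_iota a b.+1) =
    [seq l <- rev (map val (enum 'I_n)) | (a <= l <= b)%N].
  rewrite val_enum_ord filter_rev; congr rev.
  apply: (irr_sorted_eq ltn_trans ltnn).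
  - exact: iota_ltn_sorted.
  - exact/(sorted_filter ltn_trans)/iota_ltn_sorted.
  move=> l; rewrite mem_filter mem_index_iota mem_iota add0n ltnS /=.
  by case: (leqP l b) => [lb|]; rewrite ?andbF // (leq_ltn_trans lb bn) !andbT.
by rewrite big_filter -map_rev big_map.
Qed.

Theorem theorem1p3 (d : nat) (hd : (1 <= d)%N) :
  exists N : nat, (1 <= N)%N /\
    forall (k : fieldType) (A : N.-tuple 'M[k]_d),
      nilpotent_chain A -> \prod_(l <- rev (enum 'I_N)) tnth A l = 0.
Proof.
have [N N0 rN] := uniform_rank_bound d d.
exists N; split=> // k A /nilpotent_seq_tuple/rN.
rewrite subnn leqn0 mxrank_eq0 => /eqP P0; rewrite -[RHS]P0 /iprod.
under eq_bigr do rewrite (tnth_nth 0).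
by rewrite /index_iota subn0 -val_enum_ord -map_rev big_map.
Qed.
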